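(* Let $M$ be a hyperkähler manifold, $X\in TM$ a vector field which is quasi-rotational relative to the 3-axis, with associated 2-forms $\sigma_+$, $\sigma_-=-\bar\sigma_+$, and let $\sigma_0$ be the 2-form defined by $\mathcal{L}_{I_0X}\omega_0=\omega_0-\sigma_0$. Then $\sigma_+$, $\sigma_0$, $\sigma_-$ are all closed hyper $(1,1)$ forms.
   Context: A hyperkähler manifold is a smooth manifold $M$ of real dimension $4m$ with three symplectic forms $\omega_1,\omega_2,\omega_3$ such that, viewing 2-forms as bundle maps $TM\to T^*M$, the endomorphisms $I_1=\omega_3^{-1}\omega_2$, $I_2=\omega_1^{-1}\omega_3$, $I_3=\omega_2^{-1}\omega_1$ of $TM$ satisfy $I_1^2=I_2^2=I_3^2=I_1I_2I_3=-1$; the metric $g$ is given by $\omega_i(X,Y)=g(X,I_iY)$. The hyperkähler complex structures are $I(\mathbf{u})=x_1I_1+x_2I_2+x_3I_3$, $\mathbf{u}\in S^2$. Put $I_0=I_3$, $\omega_+=\tfrac12(\omega_1+i\omega_2)$, $\omega_0=\omega_3$, $\omega_-=-\tfrac12(\omega_1-i\omega_2)$. A (real) vector field $X\in TM$ is quasi-rotational relative to the 3-axis if there exists a complex-valued 2-form $\sigma_+$ on $M$ of type $(1,1)$ with respect to $I_3\equiv I_0$ such that $\mathcal{L}_X\omega_\pm=\mp i(\omega_\pm-\sigma_\pm)$ and $\mathcal{L}_X\omega_0=0$, where $\sigma_-=-\bar\sigma_+$. A 2-form is of hyper $(1,1)$ type if it is of Hodge type $(1,1)$ with respect to all hyperkähler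 complex structures of $M$ simultaneously. *)

(* Defs.v *)
From HB Require Import structures.
From mathcomp Require Import all_boot all_order all_algebra.
From mathcomp Require Import all_classical all_reals all_analysis.
Import Order.TTheory GRing.Theory Num.Theory numFieldNormedType.Exports.

Set Implicit Arguments.
Unset Strict Implicit.
Unset Printing Implicit Defensive.

Local Open Scope classical_set_scope.
Local Open Scope ring_scope.

Section CalculusRn.
Variables (R : realType) (n : nat).
Implicit Types (U : set 'rV[R]_n) (f g : 'rV[R]_n -> R).

Fixpoint Ck (k : nat) U f : Prop :=
  (forall x, U x -> continuous_at x f) /\
  if k is k'.+1 then
    forall i : 'I_n,
      (forall x, U x -> derivable f x (delta_mx 0 i)) /\
      Ck k' U ('D_(delta_mx 0 i) f)
  else True.

Definition Cinfty_on U f : Prop := forall k, Ck k U f.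

Lemma Ck_ext k U f g : open U -> (forall x, U x -> f x = g x) ->
  Ck k U f -> Ck k U g.
Proof.
move=> oU.
have near_fg (h1 h2 : 'rV[R]_n -> R) : (forall x, U x -> h1 x = h2 x) ->
    forall x, U x -> \near x, h1 x = h2 x.
  by move=> h12 x Ux; apply: filterS (open_nbhs_nbhs (conj oU Ux)) => y /h12.
have cont (h1 h2 : 'rV[R]_n -> R) x : (forall x, U x -> h1 x = h2 x) -> U x ->
    continuous_at x h1 -> continuous_at x h2.
  move=> h12 Ux; rewrite /continuous_at -(h12 x Ux) => ch1.
  exact: cvg_trans (near_eq_cvg (near_fg _ _ h12 _ Ux)) ch1.
elim: k f g => [|k IH] f g fg [cf df].
  by split=> // x Ux; apply: cont fg Ux (cf x Ux).
split=> [x Ux|i]; first exact: cont fg Ux (cf x Ux).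
have [d1 d2] := df i; split=> [x Ux|].
  exact: near_eq_derivable (near_fg _ _ fg _ Ux) (d1 x Ux).
by apply: IH d2 => x Ux; exact: near_eq_derive (near_fg _ _ fg _ Ux).
Qed.

Lemma CkW k U f : Ck k.+1 U f -> Ck k U f.
Proof.
elim: k f => [|k IH] f; first by move=> [].
move=> [cf df]; split=> // i; have [d1 d2] := df i; split=> //; exact: IH.
Qed.

Lemma Ck_cst k U c : Ck k U (cst c).
Proof.
elim: k c => [|k IH] c.
  by split=> // x _; exact: cst_continuous.
split=> [x _|i]; first exact: cst_continuous.
split=> [x _|]; first exact: derivable_cst.
have -> : 'D_(delta_mx 0 i) (cst c : 'rV[R]_n -> R) = cst 0.
  by apply/funext => x; rewrite derive_cst.
exact: IH.
Qed.

Lemma CkD k U f g : open U -> Ck k U f -> Ck k U g -> Ck k U (f + g).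
Proof.
move=> oU; elim: k f g => [|k IH] f g [cf df] [cg dg].
  by split=> // x Ux; apply: continuousD; [exact: cf|exact: cg].
split=> [x Ux|i]; first by apply: continuousD; [exact: cf|exact: cg].
have [df1 df2] := df i; have [dg1 dg2] := dg i; split=> [x Ux|].
  by apply: derivableD; [exact: df1|exact: dg1].
apply: (Ck_ext oU) (IH _ _ df2 dg2) => x Ux.
by rewrite deriveD //; [exact: df1|exact: dg1].
Qed.

Lemma CkM k U f g : open U -> Ck k U f -> Ck k U g -> Ck k U (f * g).
Proof.
move=> oU; elim: k f g => [|k IH] f g hf hg.
  by split=> // x Ux; apply: continuousM; [exact: hf.1|exact: hg.1].
split=> [x Ux|i]; first by apply: continuousM; [exact: hf.1|exact: hg.1].
have [df1 df2] := hf.2 i; have [dg1 dg2] := hg.2 i; split=> [x Ux|].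
  by apply: derivableM; [exact: df1|exact: dg1].
have h1 := IH _ _ (CkW hf) dg2; have h2 := IH _ _ (CkW hg) df2.
apply: (Ck_ext oU) (CkD oU h1 h2) => x Ux.
by rewrite deriveM //; [exact: df1|exact: dg1].
Qed.

End CalculusRn.

Record chart (R : realType) (n : nat) (T : topologicalType) := Chart {
  chart_dom : set T;
  chart_map : T -> 'rV[R]_n;
  chart_inv : 'rV[R]_n -> T;
  chart_dom_open : open chart_dom;
  chart_img_open : open (chart_map @` chart_dom);
  chart_mapK : forall x, chart_dom x -> chart_inv (chart_map x) = x;
  chart_map_cont : forall x, chart_dom x -> continuous_at x chart_map;
  chart_inv_cont :
    forall y, (chart_map @` chart_dom) y -> continuous_at y chart_inv }.

Record manifold (R : realType) (n : nat) := Manifold {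
  mpoint :> topologicalType;
  mhausdorff : hausdorff_space mpoint;
  msecond_countable : @second_countable mpoint;
  atlas : set (chart R n mpoint);
  atlas_cover : forall x, exists2 c, atlas c & chart_dom c x;
  atlas_compat : forall c c', atlas c -> atlas c' -> forall j : 'I_n,
    Cinfty_on (chart_map c @` (chart_dom c `&` chart_dom c'))
      (fun y => chart_map c' (chart_inv c y) 0 j) }.

Section SmoothFunctions.
Variables (R : realType) (n : nat) (M : manifold R n).

Definition smooth (f : M -> R) : Prop := forall c, atlas c ->
  Cinfty_on (chart_map c @` chart_dom c) (f \o chart_inv c).

Definition smooth_pred : pred (M -> R) := fun f => `[< smooth f >].

Lemma smooth_subring : subring_closed smooth_pred.
Proof.
have hcst a : cst a \in smooth_pred by apply/asboolP => c _ k; exact: Ck_cst.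
have hM : {in smooth_pred &, forall f g, f * g \in smooth_pred}.
  move=> f g /asboolP hf /asboolP hg; apply/asboolP => c ac k.
  by apply: CkM (hf c ac k) (hg c ac k); exact: chart_img_open.
split=> //; first exact: hcst.
move=> f g hf hg; rewrite -[- g]mulN1r.
have /asboolP hNg : -1 * g \in smooth_pred by apply: hM => //; exact: (hcst (-1)).
move/asboolP: hf => hf; apply/asboolP => c ac k.
by apply: CkD (hf c ac k) (hNg c ac k); exact: chart_img_open.
Qed.

Record Cinf := MkCinf { Cinf_fun :> M -> R; _ : Cinf_fun \in smooth_pred }.
HB.instance Definition _ := [isSub for Cinf_fun].
HB.instance Definition _ := [Choice of Cinf by <:].
HB.instance Definition _ :=
  GRing.SubChoice_isSubComPzRing.Build (M -> R) smooth_pred Cinf smooth_subring.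

Lemma cst_smooth (a : R) : cst a \in smooth_pred.
Proof. by apply/asboolP => c _ k; exact: Ck_cst. Qed.

Definition Cst (a : R) : Cinf := MkCinf (cst_smooth a).

End SmoothFunctions.

(* On a smooth manifold, the vector fields are exactly the R-linear derivations
   of C^oo(M). *)
Section VectorFields.
Variables (R : realType) (n : nat) (M : manifold R n).
Local Notation A := (Cinf M).

Definition derivation (X : A -> A) : Prop :=
  [/\ forall f g, X (f + g) = X f + X g,
      forall (a : R) f, X (Cst M a * f) = Cst M a * X f &
      forall f g, X (f * g) = f * X g + X f * g].

Definition derivation_pred : pred (A -> A^o) := fun X => `[< derivation X >].

Lemma derivation_submod : submod_closed derivation_pred.
Proof.
split.
  by apply/asboolP; split=> *; rewrite /GRing.zero/= ?(addr0, mulr0, mul0r).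
move=> h X Y /asboolP[X1 X2 X3] /asboolP[Y1 Y2 Y3]; apply/asboolP.
have E f : (h *: X + Y) f = h * X f + Y f by [].
split=> [f g|a f|f g]; rewrite !E.
- by rewrite X1 Y1 mulrDr addrACA.
- by rewrite X2 Y2 mulrDr mulrCA.
- by rewrite X3 Y3 !mulrDr !mulrDl mulrCA addrACA !mulrA.
Qed.

HB.instance Definition _ :=
  GRing.isSubmodClosed.Build A (A -> A^o) derivation_pred derivation_submod.

Record vect := MkVect { vect_fun :> A -> A^o; _ : vect_fun \in derivation_pred }.
HB.instance Definition _ := [isSub for vect_fun].
HB.instance Definition _ := [Choice of vect by <:].
HB.instance Definition _ := [SubChoice_isSubLmodule of vect by <:].

Lemma vectP (X : vect) : derivation X.
Proof. by case: X => X hX; exact/asboolP. Qed.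

Lemma bracket_subproof (X Y : vect) :
  (fun f : A => X (Y f) - Y (X f) : A^o) \in derivation_pred.
Proof.
have [X1 X2 X3] := vectP X; have [Y1 Y2 Y3] := vectP Y.
apply/asboolP; split=> [f g|a f|f g].
- by rewrite Y1 !X1 Y1 opprD addrACA.
- by rewrite Y2 !X2 Y2 mulrBr.
- rewrite Y3 !X3 X1 Y1 !X3 !Y3 !mulrBr !mulrBl !opprD !addrA.
  by rewrite [LHS](ACl (1*5*4*8*(2*7)*(3*6))%AC)/= !subrr !addr0.
Qed.

Definition bracket (X Y : vect) : vect := MkVect (bracket_subproof X Y).

End VectorFields.

(* Smooth tensor fields are encoded as C^oo(M)-multilinear maps on vector
   fields; a 2-form is thus an alternating C^oo(M)-bilinear map. *)
Section TwoForms.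
Variables (R : realType) (n : nat) (M : manifold R n).
Local Notation A := (Cinf M).
Local Notation V := (vect M).

Definition tensor2 (b : V -> V -> A) : Prop :=
  (forall Z, linear (fun Y => b Y Z : A^o)) /\
  (forall Y, linear (fun Z => b Y Z : A^o)).

Definition alternating2 (b : V -> V -> A) : Prop :=
  tensor2 b /\ forall Y, b Y Y = 0.

Definition form2_pred : pred (V -> V -> A^o) := fun b => `[< alternating2 b >].

Lemma form2_submod : submod_closed form2_pred.
Proof.
split.
  have E Y Z : (0 : V -> V -> A^o) Y Z = 0 by [].
  by apply/asboolP; split; [split=> [Z k X Y|Y k X Z] | move=> Y];
    rewrite !E ?scaler0 ?addr0.
move=> h a b /asboolP[[a1 a2] a3] /asboolP[[b1 b2] b3]; apply/asboolP.
have E Y Z : (h *: a + b) Y Z = h * a Y Z + b Y Z by [].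
split; first split.
- move=> Z k X Y; rewrite !E a1 b1 /GRing.scale/=.
  by rewrite !mulrDr addrACA mulrCA.
- move=> Z k X Y; rewrite !E a2 b2 /GRing.scale/=.
  by rewrite !mulrDr addrACA mulrCA.
- by move=> Y; rewrite E a3 b3 mulr0 addr0.
Qed.

HB.instance Definition _ :=
  GRing.isSubmodClosed.Build A (V -> V -> A^o) form2_pred form2_submod.

Record form2 :=
  MkForm2 { form2_fun :> V -> V -> A^o; _ : form2_fun \in form2_pred }.
HB.instance Definition _ := [isSub for form2_fun].
HB.instance Definition _ := [Choice of form2 by <:].
HB.instance Definition _ := [SubChoice_isSubLmodule of form2 by <:].

Lemma form2P (w : form2) : alternating2 w.
Proof. by case: w => w hw; exact/asboolP. Qed.

Lemma bracketDr (X Y Z : V) : bracket X (Y + Z) = bracket X Y + bracket X Z.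
Proof.
have [X1 _ _] := vectP X; apply/val_inj/funext => f.
change (X (Y f + Z f) - (Y (X f) + Z (X f)) =
        X (Y f) - Y (X f) + (X (Z f) - Z (X f))).
by rewrite X1 opprD addrACA.
Qed.

Lemma bracketZr (h : A) (X Y : V) :
  bracket X (h *: Y) = X h *: Y + h *: bracket X Y.
Proof.
have [_ _ X3] := vectP X; apply/val_inj/funext => f.
change (X (h * Y f) - h * Y (X f) = X h * Y f + h * (X (Y f) - Y (X f))).
by rewrite X3 mulrBr addrA [h * _ + _]addrC.
Qed.

Lemma form2_lie_subproof (X : V) (w : form2) :
  (fun Y Z => X (w Y Z) - w (bracket X Y) Z - w Y (bracket X Z) : A^o)
    \in form2_pred.
Proof.
have [X1 X2 X3] := vectP X; have [[w1 w2] w3] := form2P w.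
have wDl Y Z T : w (Y + Z) T = w Y T + w Z T.
  by have := w1 T 1 Y Z; rewrite !scale1r.
have w0l T : w 0 T = 0.
  by apply: (addIr (w 0 T)); rewrite -wDl add0r add0r.
have wZl h Y T : w (h *: Y) T = h * w Y T.
  by have := w1 T h Y 0; rewrite w0l !addr0.
have wDr T Y Z : w T (Y + Z) = w T Y + w T Z.
  by have := w2 T 1 Y Z; rewrite !scale1r.
have w0r T : w T 0 = 0.
  by apply: (addIr (w T 0)); rewrite -wDr add0r add0r.
have wZr h T Y : w T (h *: Y) = h * w T Y.
  by have := w2 T h Y 0; rewrite w0r !addr0.
have wC Y Z : w Y Z = - w Z Y.
  have := w3 (Y + Z); rewrite wDl !wDr !w3 add0r addr0.
  by move/eqP; rewrite addr_eq0 => /eqP.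
apply/asboolP; split; first split.
- move=> T h Y Z; rewrite bracketDr bracketZr !(wDl, wZl, X1, X3) /GRing.scale/=.
  rewrite !mulrDr !mulrN !opprD !addrA.
  by rewrite [LHS](ACl (1*5*7*3*6*8*(2*4))%AC)/= subrr addr0.
- move=> T h Y Z; rewrite bracketDr bracketZr !(wDr, wZr, X1, X3) /GRing.scale/=.
  rewrite !mulrDr !mulrN !opprD !addrA.
  by rewrite [LHS](ACl (1*4*7*3*5*8*(2*6))%AC)/= subrr addr0.
- move=> Y; have X0 : X 0 = 0.
    by apply: (addIr (X 0)); rewrite -X1 !add0r.
  by rewrite w3 X0 [w Y _]wC opprK sub0r addNr.
Qed.

Definition lie (X : V) (w : form2) : form2 := MkForm2 (form2_lie_subproof X w).

(* Koszul's formula *)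
Definition dform2 (w : form2) (X Y Z : V) : A :=
  X (w Y Z) - Y (w X Z) + Z (w X Y)
  - w (bracket X Y) Z + w (bracket X Z) Y - w (bracket Y Z) X.

Definition closed2 (w : form2) : Prop := forall X Y Z, dform2 w X Y Z = 0.

(* Nondegeneracy at every point p: a vector field Y is nonzero at p iff
   (Y f)(p) <> 0 for some smooth f. *)
Definition nondegenerate2 (b : V -> V -> A) : Prop :=
  forall (p : M) (Y : V), (exists f : A, Y f p <> 0) ->
  exists Z : V, b Y Z p <> 0.

Definition symplectic (w : form2) : Prop := closed2 w /\ nondegenerate2 w.

End TwoForms.

(* Complexification of a real module: the pair (v, w) stands for v + i w. *)
Notation cplx V := (V * V)%type.

Section Complexification.
Variables (R : realType) (n : nat) (M : manifold R n).

Definition cplx_of (V : zmodType) (v : V) : cplx V := (v, 0).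
Definition mulI (V : zmodType) (z : cplx V) : cplx V := (- z.2, z.1).
Definition cplx_conj (V : zmodType) (z : cplx V) : cplx V := (z.1, - z.2).

Definition clie (X : vect M) (s : cplx (form2 M)) : cplx (form2 M) :=
  (lie X s.1, lie X s.2).

Definition cclosed2 (s : cplx (form2 M)) : Prop := closed2 s.1 /\ closed2 s.2.

(* C-bilinear extension of s to complex vector fields *)
Definition ceval (s : cplx (form2 M)) (Z W : cplx (vect M)) : cplx (Cinf M) :=
  let ev (w : form2 M) : cplx (Cinf M) :=
    (w Z.1 W.1 - w Z.2 W.2, w Z.1 W.2 + w Z.2 W.1) in
  ev s.1 + mulI (ev s.2).

Definition cendo (J : vect M -> vect M) (Z : cplx (vect M)) : cplx (vect M) :=
  (J Z.1, J Z.2).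

(* Sections of the i- and (-i)-eigenbundles T^{1,0} and T^{0,1} of J *)
Definition vect10 (J : vect M -> vect M) (Z : cplx (vect M)) : Prop :=
  cendo J Z = mulI Z.
Definition vect01 (J : vect M -> vect M) (Z : cplx (vect M)) : Prop :=
  cendo J Z = - mulI Z.

(* The (2,0) and (0,2) components vanish. *)
Definition type11 (J : vect M -> vect M) (s : cplx (form2 M)) : Prop :=
  (forall Z W, vect10 J Z -> vect10 J W -> ceval s Z W = 0) /\
  (forall Z W, vect01 J Z -> vect01 J W -> ceval s Z W = 0).

End Complexification.

(* As bundle maps TM -> T*M, w : Y |-> w(Y, -), so that I1 = w3^-1 w2 reads
   w3(I1 Y, Z) = w2(Y, Z), which determines I1 as w3 is nondegenerate; the other
   convention Y |-> w(-, Y) yields the same I1.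
   No signature is prescribed for the metric, which is determined by the rest of
   the data. *)
Record hyperkahler (R : realType) (m : nat) (M : manifold R (4 * m)) :=
    Hyperkahler {
  hk_w1 : form2 M;
  hk_w2 : form2 M;
  hk_w3 : form2 M;
  hk_symp1 : symplectic hk_w1;
  hk_symp2 : symplectic hk_w2;
  hk_symp3 : symplectic hk_w3;
  hk_I1 : {linear vect M -> vect M};
  hk_I2 : {linear vect M -> vect M};
  hk_I3 : {linear vect M -> vect M};
  hk_I1E : forall Y Z, hk_w3 (hk_I1 Y) Z = hk_w2 Y Z;
  hk_I2E : forall Y Z, hk_w1 (hk_I2 Y) Z = hk_w3 Y Z;
  hk_I3E : forall Y Z, hk_w2 (hk_I3 Y) Z = hk_w1 Y Z;
  hk_sqr1 : forall Y, hk_I1 (hk_I1 Y) = - Y;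
  hk_sqr2 : forall Y, hk_I2 (hk_I2 Y) = - Y;
  hk_sqr3 : forall Y, hk_I3 (hk_I3 Y) = - Y;
  hk_I123 : forall Y, hk_I1 (hk_I2 (hk_I3 Y)) = - Y;
  hk_g : vect M -> vect M -> Cinf M;
  hk_g_tensor : tensor2 hk_g;
  hk_g_sym : forall Y Z, hk_g Y Z = hk_g Z Y;
  hk_g1 : forall Y Z, hk_w1 Y Z = hk_g Y (hk_I1 Z);
  hk_g2 : forall Y Z, hk_w2 Y Z = hk_g Y (hk_I2 Z);
  hk_g3 : forall Y Z, hk_w3 Y Z = hk_g Y (hk_I3 Z) }.

Section Hyperkahler.
Variables (R : realType) (m : nat) (M : manifold R (4 * m)) (H : hyperkahler M).

Definition hk_cs (x1 x2 x3 : R) (Y : vect M) : vect M :=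
  Cst M x1 *: hk_I1 H Y + Cst M x2 *: hk_I2 H Y + Cst M x3 *: hk_I3 H Y.

Definition hk_I0 : {linear vect M -> vect M} := hk_I3 H.

Definition hk_wp : cplx (form2 M) :=
  Cst M 2^-1 *: (cplx_of (hk_w1 H) + mulI (cplx_of (hk_w2 H))).
Definition hk_w0 : form2 M := hk_w3 H.
Definition hk_wm : cplx (form2 M) :=
  - (Cst M 2^-1 *: (cplx_of (hk_w1 H) - mulI (cplx_of (hk_w2 H)))).

Definition hyper11 (s : cplx (form2 M)) : Prop :=
  forall x1 x2 x3 : R, x1 ^+ 2 + x2 ^+ 2 + x3 ^+ 2 = 1 ->
  type11 (hk_cs x1 x2 x3) s.

Definition quasi_rotational_with (X : vect M) (sp : cplx (form2 M)) : Prop :=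
  let sm := - cplx_conj sp in
  [/\ type11 hk_I0 sp,
      clie X hk_wp = - mulI (hk_wp - sp),
      clie X hk_wm = mulI (hk_wm - sm) &
      lie X hk_w0 = 0].

Definition quasi_rotational (X : vect M) : Prop :=
  exists sp, quasi_rotational_with X sp.

End Hyperkahler.

(* Main.v *)
Require Import Defs.
From mathcomp Require Import all_boot all_order all_algebra ring.
From mathcomp Require Import all_classical all_reals all_analysis.
Import GRing.Theory.
Set Implicit Arguments.
Unset Strict Implicit.
Unset Printing Implicit Defensive.
Local Open Scope ring_scope.

(** Call a 2-form w skew for an almost complex structure J when
    w(JY, Z) = - w(Y, JZ), that is, when w is of type (1,1) for J.  Skewness is
    linear in J and passes to products of anticommuting structures, so a form
    that is skew for two of I1, I2, I3 is of hyper (1,1) type.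

    The two real components of the quasi-rotational equations say that, up to
    the factor 1/2, sigma_+ has real part w1 + L_X w2 and imaginary part
    w2 - L_X w1, while sigma_0 = w3 - L_(I3 X) w3.  Closedness is then immediate:
    Lie derivatives of closed forms are exact, since L_X w = d(w(X, -)).

    For the type, the key is that each complex structure is integrable: the
    Nijenhuis tensor N of J = t^-1 e vanishes if t and e are closed and J^2 = -1
    (nijenhuis_eq0).  For an integrable J and a 1-form a, the (2,0) + (0,2) part
    of d(a o J) is determined by that of da (dform1_comp):

      d(a o J)(Y, Z) - d(a o J)(JY, JZ) = da(JY, Z) + da(Y, JZ).

    The 1-forms w1(X, -), w2(X, -), w3(X, -) and w3(I3 X, -), whose differentials
    are the Lie derivatives at hand, are related by I1 and I2:
      w2(X, -) = w3(X, I1 -),         w3(X, -) = w1(X, I2 -),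
      w1(X, -) = w3(I3 X, I1 -),      w2(X, -) = w3(I3 X, I2 -).
    As L_X w3 = 0, the first two make L_X w2 skew for I1 and L_X w1 skew for I2;
    w1 is skew for I1, w2 is skew for I2, and sigma_+ is skew for I3 by
    hypothesis, so sigma_+ is of hyper (1,1) type (skew_rotation).  The last two
    then show that the parts of L_(I3 X) w3 and w3 which are not skew for I1 and
    I2 agree, so that sigma_0 is skew for both (skew_moment). *)

(** * Calculus of vector fields and differential forms *)

Section Cartan.
Variables (R : realType) (n : nat) (M : manifold R n).
Local Notation A := (Cinf M).
Local Notation V := (vect M).
Implicit Types (w : form2 M) (X Y Z U : V) (f g : A) (c : R).

Lemma Cinf_ext f g : (forall p, f p = g p) -> f = g.
Proof. by move=> fg; apply/val_inj/funext. Qed.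

Lemma vect_ext X Y : (forall f, X f = Y f) -> X = Y.
Proof. by move=> XY; apply/val_inj/funext. Qed.

Lemma Cst_halfD : Cst M 2^-1 + Cst M 2^-1 = 1.
Proof. by apply: Cinf_ext => p; change (2^-1 + 2^-1 = 1 :> R); field. Qed.

Lemma Cinf_double_eq0 f : f + f = 0 -> f = 0.
Proof. by move=> f0; rewrite -[f]mul1r -Cst_halfD mulrDl -mulrDr f0 mulr0. Qed.

Lemma vectD X f g : X (f + g) = X f + X g.
Proof. by have [] := vectP X. Qed.

Lemma vectB X f g : X (f - g) = X f - X g.
Proof. by apply: (addIr (X g)); rewrite -vectD !subrK. Qed.

Lemma vect0 X : X 0 = 0.
Proof. by have := vectB X 0 0; rewrite !subrr. Qed.

Lemma vectN X f : X (- f) = - X f.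
Proof. by rewrite -sub0r vectB vect0 sub0r. Qed.

Lemma vectCst X c f : X (Cst M c * f) = Cst M c * X f.
Proof. by have [] := vectP X. Qed.

Lemma bracketE X Y f : bracket X Y f = X (Y f) - Y (X f).
Proof. by []. Qed.

Lemma jacobi X Y Z :
  bracket (bracket X Y) Z - bracket (bracket X Z) Y + bracket (bracket Y Z) X
  = 0.
Proof.
apply: vect_ext => f.
change (bracket (bracket X Y) Z f - bracket (bracket X Z) Y f
        + bracket (bracket Y Z) X f = 0).
by rewrite !bracketE !vectB; ring.
Qed.

Lemma form2Dl w X Y Z : w (X + Y) Z = w X Z + w Y Z.
Proof. by have [[/(_ Z 1 X Y)]] := form2P w; rewrite !scale1r. Qed.

Lemma form2Dr w X Y Z : w X (Y + Z) = w X Y + w X Z.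
Proof. by have [[_ /(_ X 1 Y Z)]] := form2P w; rewrite !scale1r. Qed.

Lemma form2Bl w X Y Z : w (X - Y) Z = w X Z - w Y Z.
Proof. by apply: (addIr (w Y Z)); rewrite -form2Dl !subrK. Qed.

Lemma form2Nl w X Y : w (- X) Y = - w X Y.
Proof. by rewrite -[- X]add0r -(subrr X) !form2Bl subrr sub0r. Qed.

Lemma form2C w X Y : w X Y = - w Y X.
Proof.
have [_ w0] := form2P w.
have := w0 (X + Y); rewrite form2Dl !form2Dr !w0 add0r addr0.
by move/eqP; rewrite addr_eq0 => /eqP.
Qed.

Lemma form2Nr w X Y : w X (- Y) = - w X Y.
Proof. by rewrite form2C form2Nl -form2C. Qed.

Lemma form2Zl w f X Y : w (f *: X) Y = f * w X Y.
Proof.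
have [[/(_ Y f X 0)]] := form2P w; rewrite addr0 => -> _ _.
by rewrite -(subrr X) form2Bl subrr addr0.
Qed.

Lemma form2Zr w f X Y : w X (f *: Y) = f * w X Y.
Proof. by rewrite form2C form2Zl form2C mulrN opprK. Qed.

(** Nondegeneracy is a condition at each point, but it yields injectivity on
    global vector fields. *)
Lemma nondegenerate2_eq0 w X :
  nondegenerate2 w -> (forall Y, w X Y = 0) -> X = 0.
Proof.
move=> ndw wX0; apply: vect_ext => f; apply: Cinf_ext => p.
apply: contrapT => Xfp; have [|Y] := ndw p X; first by exists f.
by rewrite wX0.
Qed.

Definition dform1 (a : V -> A) X Y : A := X (a Y) - Y (a X) - a (bracket X Y).

(** Cartan's formula L_X w = d(i_X w) + i_X dw for closed [w]. *)
Lemma cartan w X Y Z : closed2 w -> lie X w Y Z = dform1 (w X) Y Z.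
Proof.
move=> /(_ X Y Z) dw0; rewrite -[LHS]subr0 -dw0 /dform2 /dform1 /=.
rewrite [w (bracket Y Z) X]form2C [w (bracket X Z) Y]form2C.
rewrite [w (bracket X Y) Z]form2C; ring.
Qed.

(** d o d = 0: second derivatives cancel in pairs, and the values of [a] at
    iterated brackets sum to zero by the Jacobi identity. *)
Lemma exact_closed2 (a : V -> A) w : {morph a : X Y / X + Y} ->
  (forall X Y, w X Y = dform1 a X Y) -> closed2 w.
Proof.
move=> aD wE X Y Z.
have aB U T : a (U - T) = a U - a T.
  by apply/esym/eqP; rewrite subr_eq -aD subrK.
have := congr1 a (jacobi X Y Z); rewrite aD aB -(subrr 0) aB subrr => J.
rewrite -[RHS]J /dform2 !wE /dform1 !vectB !bracketE; ring.
Qed.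

Lemma closed2_lie X w : closed2 w -> closed2 (lie X w).
Proof.
move=> dw0; apply: (@exact_closed2 (w X)) => [Y Z|Y Z]; first exact: form2Dr.
exact: cartan.
Qed.

Lemma closed2D w1 w2 : closed2 w1 -> closed2 w2 -> closed2 (w1 + w2).
Proof.
move=> d1 d2 X Y Z; have E U T : (w1 + w2) U T = w1 U T + w2 U T by [].
rewrite -[RHS]addr0 -{1}(d1 X Y Z) -(d2 X Y Z) /dform2 !E !vectD; ring.
Qed.

Lemma closed2Z c w : closed2 w -> closed2 (Cst M c *: w).
Proof.
move=> dw X Y Z; have E U T : (Cst M c *: w) U T = Cst M c * w U T by [].
rewrite -[RHS](mulr0 (Cst M c)) -(dw X Y Z) /dform2 !E !vectCst; ring.
Qed.

Lemma closed2N w : closed2 w -> closed2 (- w).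
Proof.
move=> dw X Y Z; have E U T : (- w) U T = - w U T by [].
rewrite -[RHS]oppr0 -(dw X Y Z) /dform2 !E !vectN; ring.
Qed.

Lemma lieZ X c w : lie X (Cst M c *: w) = Cst M c *: lie X w.
Proof.
apply/val_inj/funext => Y; apply/funext => Z.
change (X (Cst M c * w Y Z) - Cst M c * w (bracket X Y) Z
        - Cst M c * w Y (bracket X Z) = Cst M c * lie X w Y Z).
by rewrite vectCst /= !mulrBr.
Qed.

(** * Integrability of the complex structures *)

Definition nijenhuis (J : V -> V) X Y : V :=
  bracket (J X) (J Y) - bracket X Y - J (bracket (J X) Y) - J (bracket X (J Y)).

(** The kernel of the closed complex form t - i e is the (0,1) bundle of
    [J], and the kernel of a closed form is involutive.  In real terms,
    t(N(X, Y), Z) is the real part of d(t - i e)(X + i JX, Y + i JY, Z), where N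
    is the Nijenhuis tensor. *)
Lemma nijenhuis_eq0 (J : {linear V -> V}) (t e : form2 M) :
  symplectic t -> closed2 e -> (forall X Y, t (J X) Y = e X Y) ->
  (forall X, J (J X) = - X) -> forall X Y, nijenhuis J X Y = 0.
Proof.
move=> [dt ndt] de tJ JJ X Y; apply: (nondegenerate2_eq0 ndt) => Z.
have tJr U T : t U (J T) = t (J U) T by rewrite form2C !tJ -form2C.
have -> : 0 = dform2 t X Y Z - dform2 t (J X) (J Y) Z
              + dform2 e (J X) Y Z + dform2 e X (J Y) Z.
  by rewrite !dt !de subr0 !addr0.
rewrite /dform2 -!tJ !(tJr, JJ) !(form2Nl, vectN) /nijenhuis !form2Bl; ring.
Qed.

(** The terms that differentiate values of [a] cancel, and what remains is
    [a (J (nijenhuis J X Y))]. *)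
Lemma dform1_comp (J : {linear V -> V}) (a b : V -> A) X Y :
  {morph a : Y Z / Y + Z} -> (forall Z, a (J Z) = b Z) ->
  (forall Z, J (J Z) = - Z) -> nijenhuis J X Y = 0 ->
  dform1 b X Y - dform1 b (J X) (J Y) = dform1 a (J X) Y + dform1 a X (J Y).
Proof.
move=> aD aJ JJ N0.
have aB U T : a (U - T) = a U - a T.
  by apply: (addIr (a T)); rewrite -aD !subrK.
have a0 : a 0 = 0 by have := aB 0 0; rewrite !subrr.
have aN U : a (- U) = - a U by rewrite -sub0r aB a0 sub0r.
have := congr1 (a \o J) N0.
rewrite /= /nijenhuis !raddfB raddf0 /= !aB !JJ !aN a0 => JN0.
rewrite /dform1 -!aJ !JJ !aN !vectN; apply/eqP; rewrite -subr_eq0.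
by rewrite -[X in _ == X]JN0; apply/eqP; ring.
Qed.

(** * Forms of type (1,1) *)

Definition skew (J : V -> V) w := forall X Y, w (J X) Y = - w X (J Y).

Lemma skewD J w1 w2 : skew J w1 -> skew J w2 -> skew J (w1 + w2).
Proof.
move=> s1 s2 X Y; have E U T : (w1 + w2) U T = w1 U T + w2 U T by [].
by rewrite !E s1 s2 opprD.
Qed.

Lemma skewZ J f w : skew J w -> skew J (f *: w).
Proof.
move=> s X Y; have E U T : (f *: w) U T = f * w U T by [].
by rewrite !E s mulrN.
Qed.

Lemma skewN J w : skew J w -> skew J (- w).
Proof.
by move=> s X Y; have E U T : (- w) U T = - w U T by []; rewrite !E s.
Qed.

Lemma skew_comp (J K L : V -> V) w :
  (forall X, J (K X) = L X) -> (forall X, K (J X) = - L X) ->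
  skew J w -> skew K w -> skew L w.
Proof. by move=> JK KJ sJ sK X Y; rewrite -JK sJ sK KJ form2Nr !opprK. Qed.

Lemma skew_invariant (J : V -> V) w : (forall X, J (J X) = - X) ->
  skew J w <-> forall X Y, w (J X) (J Y) = w X Y.
Proof.
move=> JJ; split=> s X Y; first by rewrite s JJ form2Nr opprK.
by rewrite -s JJ form2Nl.
Qed.

Lemma cevalE (s : cplx (form2 M)) (Z W : cplx V) :
  ceval s Z W =
  (s.1 Z.1 W.1 - s.1 Z.2 W.2 - (s.2 Z.1 W.2 + s.2 Z.2 W.1),
   s.1 Z.1 W.2 + s.1 Z.2 W.1 + (s.2 Z.1 W.1 - s.2 Z.2 W.2)).
Proof. by []. Qed.

(** On eigenvectors Z, W of [J] for one eigenvalue c = i or -i, skewness gives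
    c s(Z, W) = - c s(Z, W); here this is read off on real and imaginary parts. *)
Lemma skew_type11 (J : V -> V) (s : cplx (form2 M)) :
  skew J s.1 -> skew J s.2 -> type11 J s.
Proof.
have w10 w Z1 Z2 W1 W2 : skew J w -> J Z2 = Z1 -> J W1 = - W2 -> J W2 = W1 ->
    w Z1 W1 = w Z2 W2 /\ w Z1 W2 = - w Z2 W1.
  by move=> sw <- JW1 JW2; rewrite !sw JW1 JW2 form2Nr opprK.
have w01 w Z1 Z2 W1 W2 : skew J w -> J Z1 = Z2 -> J W1 = W2 -> J W2 = - W1 ->
    w Z1 W1 = w Z2 W2 /\ w Z1 W2 = - w Z2 W1.
  by move=> sw <- JW1 JW2; rewrite !sw JW1 JW2 form2Nr !opprK.
move=> s1 s2; split=> -[Z1 Z2] [W1 W2]; rewrite /vect10 /vect01 /cendo /mulI /=.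
  move=> [_ JZ2] [JW1 JW2]; rewrite cevalE /=.
  have [-> ->] := w10 _ _ _ _ _ s1 JZ2 JW1 JW2.
  have [-> ->] := w10 _ _ _ _ _ s2 JZ2 JW1 JW2.
  by rewrite !addNr !subrr ?addr0.
move=> [JZ1 _] [JW1 JW2]; rewrite cevalE /=.
rewrite opprK in JZ1; rewrite opprK in JW1.
have [-> ->] := w01 _ _ _ _ _ s1 JZ1 JW1 JW2.
have [-> ->] := w01 _ _ _ _ _ s2 JZ1 JW1 JW2.
by rewrite !addNr !subrr ?addr0.
Qed.

(** The (2,0) condition on X - i JX and Y - i JY, and the (0,2) condition on the
    conjugate fields, mix the two components of [s] with opposite signs, so that
    their sums and differences separate these components. *)
Lemma type11_skew (J : {linear V -> V}) (s : cplx (form2 M)) :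
  (forall X, J (J X) = - X) -> type11 J s -> skew J s.1 /\ skew J s.2.
Proof.
move=> JJ [s10 s01].
suff E X Y : s.1 (J X) Y = - s.1 X (J Y) /\ s.2 (J X) Y = - s.2 X (J Y).
  by split=> X Y; case: (E X Y).
have := s10 (X, - J X) (Y, - J Y); have := s01 (X, J X) (Y, J Y).
rewrite /vect10 /vect01 /cendo /mulI /= !raddfN /= !JJ !opprK !cevalE /=.
rewrite !(form2Nl, form2Nr) !opprK => h01 h10.
have E T : (J T, - T) = - (- J T, T) by rewrite -[in LHS](opprK (J T)).
have e1 := congr1 fst (h01 (E X) (E Y)).
have e2 := congr1 snd (h01 (E X) (E Y)).
have e3 := congr1 fst (h10 erefl erefl).
have e4 := congr1 snd (h10 erefl erefl).
have K (a b c : A) : a + b + c = 0 -> - a - b + c = 0 -> b = - a.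
  move=> h1 h2; apply/eqP; rewrite -addr_eq0; apply/eqP/Cinf_double_eq0.
  by transitivity (a + b + c - (- a - b + c)); [ring | rewrite h1 h2 subr0].
split.
  exact: (K (s.1 X (J Y)) (s.1 (J X) Y) (s.2 X Y - s.2 (J X) (J Y))).
apply: (K (s.2 X (J Y)) (s.2 (J X) Y) (s.1 X Y - s.1 (J X) (J Y))).
  by apply: etrans e3 => /=; ring.
by apply: etrans e1 => /=; ring.
Qed.

End Cartan.

(** * The hyperkahler triple *)

Section Hyperkahler.
Variables (R : realType) (m : nat) (M : manifold R (4 * m)).
Variable H : hyperkahler M.
Implicit Types (X Y Z : vect M) (w : form2 M).
Local Notation I1 := (hk_I1 H).
Local Notation I2 := (hk_I2 H).
Local Notation I3 := (hk_I3 H).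
Local Notation w1 := (hk_w1 H).
Local Notation w2 := (hk_w2 H).
Local Notation w3 := (hk_w3 H).

Lemma hk_I12 Y : I1 (I2 Y) = I3 Y.
Proof.
by apply: oppr_inj; rewrite -(hk_I123 H (I3 Y)) hk_sqr3 !raddfN.
Qed.

Lemma hk_I23 Y : I2 (I3 Y) = I1 Y.
Proof.
by have := hk_sqr1 H (I2 (I3 Y)); rewrite hk_I123 raddfN => /oppr_inj.
Qed.

Lemma hk_I21 Y : I2 (I1 Y) = - I3 Y.
Proof. by rewrite -hk_I23 hk_sqr2. Qed.

Lemma hk_I32 Y : I3 (I2 Y) = - I1 Y.
Proof. by rewrite -hk_I12 hk_sqr2 raddfN. Qed.

Lemma hk_I13 Y : I1 (I3 Y) = - I2 Y.
Proof. by rewrite -hk_I12 hk_sqr1. Qed.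

Lemma hk_I31 Y : I3 (I1 Y) = I2 Y.
Proof. by rewrite -[I1 Y]hk_I23 hk_I32 hk_I13 opprK. Qed.

Definition hyper_skew w := [/\ skew I1 w, skew I2 w & skew I3 w].

Lemma hyper_skewZ f w : hyper_skew w -> hyper_skew (f *: w).
Proof. by case=> s1 s2 s3; split; exact: skewZ. Qed.

Lemma hyper_skewN w : hyper_skew w -> hyper_skew (- w).
Proof. by case=> s1 s2 s3; split; exact: skewN. Qed.

Lemma hyper_skew0 : hyper_skew 0.
Proof. by split=> Y Z; rewrite -[RHS]mulN1r [RHS]mulr0. Qed.

(** Skewness is linear in the complex structure, so the three generators suffice
    for the whole sphere. *)
Lemma hyper_skew_hyper11 (s : cplx (form2 M)) :
  hyper_skew s.1 -> hyper_skew s.2 -> hyper11 H s.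
Proof.
have cs_skew w x1 x2 x3 : hyper_skew w -> skew (hk_cs H x1 x2 x3) w.
  case=> s1 s2 s3 Y Z.
  rewrite /hk_cs !(form2Dl, form2Dr) !(form2Zl, form2Zr) s1 s2 s3.
  by rewrite !mulrN !opprD.
by move=> h1 h2 x1 x2 x3 _; apply: skew_type11; exact: cs_skew.
Qed.

Lemma hk_skew1 : skew I1 w1.
Proof. by move=> Y Z; rewrite -form2C !hk_g1 hk_g_sym. Qed.

Lemma hk_skew2 : skew I2 w2.
Proof. by move=> Y Z; rewrite -form2C !hk_g2 hk_g_sym. Qed.

Lemma hk_w3I1 Y Z : w3 Y (I1 Z) = w2 Y Z.
Proof. by rewrite form2C hk_I1E -form2C. Qed.

Lemma hk_w1I2 Y Z : w1 Y (I2 Z) = w3 Y Z.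
Proof. by rewrite form2C hk_I2E -form2C. Qed.

Lemma hk_nijenhuis1 Y Z : nijenhuis I1 Y Z = 0.
Proof.
exact: (nijenhuis_eq0 (hk_symp3 H) (hk_symp2 H).1 (hk_I1E H) (hk_sqr1 H)).
Qed.

Lemma hk_nijenhuis2 Y Z : nijenhuis I2 Y Z = 0.
Proof.
exact: (nijenhuis_eq0 (hk_symp1 H) (hk_symp3 H).1 (hk_I2E H) (hk_sqr2 H)).
Qed.

(** The 1-forms of [dform1_comp] are here contractions of closed 2-forms, whose
    differentials are Lie derivatives. *)
Lemma lie_comp (J : {linear vect M -> vect M}) (t e : form2 M) X X' :
  closed2 t -> closed2 e -> (forall Z, t X (J Z) = e X' Z) ->
  (forall Z, J (J Z) = - Z) -> (forall Y Z, nijenhuis J Y Z = 0) ->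
  forall Y Z, lie X' e Y Z - lie X' e (J Y) (J Z)
              = lie X t (J Y) Z + lie X t Y (J Z).
Proof.
move=> dt de tJ JJ N0 Y Z; rewrite !cartan //.
by apply: dform1_comp => //; exact: form2Dr.
Qed.

Lemma skew_lie_w2 X : lie X w3 = 0 -> skew I1 (lie X w2).
Proof.
move=> L3; apply/(skew_invariant _ (hk_sqr1 H)) => Y Z.
have := lie_comp (hk_symp3 H).1 (hk_symp2 H).1 (hk_w3I1 X) (hk_sqr1 H)
  hk_nijenhuis1 Y Z.
by rewrite L3 [RHS]addr0 => /eqP; rewrite subr_eq0 => /eqP.
Qed.

Lemma skew_lie_w1 X : lie X w3 = 0 -> skew I2 (lie X w1).
Proof.
move=> L3 Y Z.
have := lie_comp (hk_symp1 H).1 (hk_symp3 H).1 (hk_w1I2 X) (hk_sqr2 H)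
  hk_nijenhuis2 Y Z.
by rewrite L3 [LHS]subrr => /esym/eqP; rewrite addr_eq0 => /eqP.
Qed.

(** * The forms sigma_+ and sigma_0 *)

Lemma skew_rotation X : lie X w3 = 0 ->
  skew I3 (w1 + lie X w2) -> skew I3 (w2 - lie X w1) ->
  hyper_skew (w1 + lie X w2) /\ hyper_skew (w2 - lie X w1).
Proof.
move=> L3 s31 s32; split.
  have s1 := skewD hk_skew1 (skew_lie_w2 L3).
  by split=> //; exact: skew_comp hk_I31 hk_I13 s31 s1.
have s2 := skewD hk_skew2 (skewN (skew_lie_w1 L3)).
by split=> //; exact: skew_comp hk_I23 hk_I32 s2 s32.
Qed.

(** For J = I1, [lie_comp], the invariance of w2 - L_X w1 and the quaternion
    relations identify the defects of skewness of L_(I3 X) w3 and w3: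
      (L_(I3 X) w3)(JY, Z) + (L_(I3 X) w3)(Y, JZ)
      = (L_X w1)(Y, Z) - (L_X w1)(JY, JZ) = w2(Y, Z) - w2(JY, JZ)
      = 2 w2(Y, Z) = w3(JY, Z) + w3(Y, JZ).
    For J = I2 the same holds with L_X w2 and - w1 for L_X w1 and w2. *)
Lemma skew_moment X :
  skew I1 (w2 - lie X w1) -> skew I2 (w1 + lie X w2) ->
  hyper_skew (w3 - lie (I3 X) w3).
Proof.
move=> s1 s2; set s := w3 - _.
suff [s31 s32] : skew I1 s /\ skew I2 s.
  by split=> //; apply: skew_comp hk_I12 hk_I21 s31 s32.
have sE Y Z : s Y Z = w3 Y Z - lie (I3 X) w3 Y Z by [].
have dE (u v : form2 M) Y Z : (u - v) Y Z = u Y Z - v Y Z by [].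
have aE (u v : form2 M) Y Z : (u + v) Y Z = u Y Z + v Y Z by [].
split=> Y Z; apply/eqP; rewrite -addr_eq0 !sE; apply/eqP.
  have tE Z' : w3 (I3 X) (I1 Z') = w1 X Z' by rewrite hk_w3I1 hk_I3E.
  have := lie_comp (hk_symp3 H).1 (hk_symp1 H).1 tE (hk_sqr1 H)
    hk_nijenhuis1 Y Z.
  have := (skew_invariant _ (hk_sqr1 H)).1 s1 Y Z; rewrite !dE.
  have -> : w2 (I1 Y) (I1 Z) = - w2 Y Z.
    by rewrite -hk_I1E hk_sqr1 form2Nl hk_w3I1.
  move=> e1 /esym/(canRL (addrK _)) ->; rewrite hk_I1E hk_w3I1.
  rewrite -[RHS](subrr (w2 Y Z - lie X w1 Y Z)) -{2}e1; ring.
have tE Z' : w3 (I3 X) (I2 Z') = w2 X Z'.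
  by rewrite -hk_I2E hk_w1I2 hk_I23 hk_I1E.
have := lie_comp (hk_symp3 H).1 (hk_symp2 H).1 tE (hk_sqr2 H)
  hk_nijenhuis2 Y Z.
have := (skew_invariant _ (hk_sqr2 H)).1 s2 Y Z; rewrite !aE.
have w3l : w3 (I2 Y) Z = - w1 Y Z by rewrite -hk_I2E hk_sqr2 form2Nl.
have w3r : w3 Y (I2 Z) = - w1 Y Z by rewrite -hk_w1I2 hk_sqr2 form2Nr.
have -> : w1 (I2 Y) (I2 Z) = - w1 Y Z by rewrite hk_I2E w3r.
move=> e1 /esym/(canRL (addrK _)) ->; rewrite w3l w3r.
rewrite -[RHS](subrr (w1 Y Z + lie X w2 Y Z)) -{1}e1; ring.
Qed.

Lemma quasi_rotational_real X sp : quasi_rotational_with H X sp ->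
  [/\ sp.1 = Cst M 2^-1 *: (w1 + lie X w2),
      sp.2 = Cst M 2^-1 *: (w2 - lie X w1),
      skew I3 (w1 + lie X w2), skew I3 (w2 - lie X w1) & lie X w3 = 0].
Proof.
case=> t11 Lp _ L0; have [s1 s2] := type11_skew (hk_sqr3 H) t11.
have wp1 : (hk_wp H).1 = Cst M 2^-1 *: w1 by rewrite /= oppr0 addr0.
have wp2 : (hk_wp H).2 = Cst M 2^-1 *: w2 by rewrite /= add0r.
have p1 : lie X (hk_wp H).1 = - - ((hk_wp H).2 - sp.2) := congr1 fst Lp.
have p2 : lie X (hk_wp H).2 = - ((hk_wp H).1 - sp.1) := congr1 snd Lp.
move: p1 p2; rewrite wp1 wp2 !lieZ opprK opprB => p1 p2.
have sp1 : sp.1 = Cst M 2^-1 *: (w1 + lie X w2).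
  by rewrite scalerDr p2 addrC subrK.
have sp2 : sp.2 = Cst M 2^-1 *: (w2 - lie X w1).
  by rewrite scalerBr p1 opprB addrC subrK.
have double w : w = Cst M 2^-1 *: w + Cst M 2^-1 *: w.
  by rewrite -scalerDl Cst_halfD scale1r.
split=> //; rewrite [X in skew _ X]double.
  by rewrite -sp1; exact: skewD.
by rewrite -sp2; exact: skewD.
Qed.

End Hyperkahler.

Theorem proposition25 (R : realType) (m : nat) (M : manifold R (4 * m))
    (H : hyperkahler M) (X : vect M) (sp sm : cplx (form2 M)) (s0 : form2 M) :
  quasi_rotational_with H X sp ->
  sm = - cplx_conj sp ->
  lie (hk_I0 H X) (hk_w0 H) = hk_w0 H - s0 ->
  [/\ cclosed2 sp /\ hyper11 H sp,
      closed2 s0 /\ hyper11 H (cplx_of s0) &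
      cclosed2 sm /\ hyper11 H sm].
Proof.
move=> qr -> L0.
have [sp1 sp2 s31 s32 L3] := quasi_rotational_real qr.
have [h1 h2] := skew_rotation L3 s31 s32.
have s0E : s0 = hk_w3 H - lie (hk_I3 H X) (hk_w3 H) by rewrite L0 subKr.
have h0 : hyper_skew H s0.
  by rewrite s0E; case: h1 h2 => [_ s2 _] [s1 _ _]; exact: skew_moment.
have {}h1 : hyper_skew H sp.1 by rewrite sp1; exact: hyper_skewZ.
have {}h2 : hyper_skew H sp.2 by rewrite sp2; exact: hyper_skewZ.
have c1 : closed2 sp.1.
  rewrite sp1; apply/closed2Z/closed2D; first exact: (hk_symp1 H).1.
  exact: closed2_lie (hk_symp2 H).1.
have c2 : closed2 sp.2.
  rewrite sp2; apply/closed2Z/closed2D; first exact: (hk_symp2 H).1.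
  by apply/closed2N/closed2_lie; exact: (hk_symp1 H).1.
have c0 : closed2 s0.
  rewrite s0E; apply: closed2D; first exact: (hk_symp3 H).1.
  by apply/closed2N/closed2_lie; exact: (hk_symp3 H).1.
split; split.
- by split.
- exact: hyper_skew_hyper11.
- exact: c0.
- by apply: hyper_skew_hyper11 => //; exact: hyper_skew0.
- by split; [exact: closed2N | exact/closed2N/closed2N].
- by apply: hyper_skew_hyper11; [|apply: hyper_skewN]; exact: hyper_skewN.
Qed.
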